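(* Let $d\ge2$, let $T\in\mathbb{R}^{n_1\times\cdots\times n_d}$ be given by a TR-representation with cores $G_1,\ldots,G_d$, and let $k\in\{1,\ldots,d\}$. If $\widetilde T$ denotes the output of the edge deletion algorithm called with input $T$ and edge $k$ to be deleted, then $\widetilde T$ (in its returned TR-representation) has $(k-1)$-th TR-rank equal to $1$, and $\widetilde T(i_1,\ldots,i_d)=T(i_1,\ldots,i_d)$ for all $i_1,\ldots,i_d$.
   Context: TR-format: cores $G_j\in\mathbb{R}^{r_{j-1}\times n_j\times r_j}$ ($j=1,\ldots,d$, $r_d=r_0$), with matrix slices $G_j(i_j)\in\mathbb{R}^{r_{j-1}\times r_j}$, represent $T(i_1,\ldots,i_d)=\operatorname{Trace}(G_1(i_1)\cdots G_d(i_d))=\sum_{\alpha_0,\ldots,\alpha_{d-1}}\prod_{j=1}^dG_j(\alpha_{j-1},i_j,\alpha_j)$ with $\alpha_d=\alpha_0$. The vector $(r_0,\ldots,r_d)$ is the TR-rank; its entry $r_j$ is the $j$-th TR-rank. Indices of cores are taken cyclically modulo $d$ (so core $0$ is core $d$ and core $d+1$ is core $1$). Cyclic shifts: let $\gamma$ be the permutation of $\{1,\ldots,d\}$ with $\gamma(1)=d$ and $\gamma(j)=j-1$ for $j\ge2$, and $\tau_k=\gamma^{k-1}$. For a cyclic shift $\tau$, $T^{\tau}(i_1,\ldots,i_d)=T(i_{\tau(1)},\ldots,i_{\tau(d)})$; if $T$ has TR-cores $G_1,\ldots,G_d$, then $T^\tau$ has TR-cores $G_{\tau^{-1}(1)},\ldots,G_{\tau^{-1}(d)}$.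 In particular $T^{\tau_k}$ has cores $G_k,G_{k+1},\ldots,G_{k-1}$. Addition of TR-representations whose $0$-th ranks are all $1$: if tensors have cores $G_j^{(\ell)}$, $\ell=1,\ldots,m$, with $0$-th rank $1$, their sum is represented by the cores $[G_1^{(1)}(i_1)\ \cdots\ G_1^{(m)}(i_1)]$ (horizontal concatenation) for $j=1$, the block diagonal matrices $\operatorname{diag}(G_j^{(1)}(i_j),\ldots,G_j^{(m)}(i_j))$ for $2\le j\le d-1$, and the vertical concatenation of $G_d^{(1)}(i_d),\ldots,G_d^{(m)}(i_d)$ for $j=d$. Edge deletion algorithm (input: TR-cores $G_1,\ldots,G_d$ of $T$, index $k$, the edge being that between vertices $k-1$ and $k$): (1) For $\ell=1,\ldots,r_{k-1}$ define $T_\ell(i_1,\ldots,i_d)=\sum_{\alpha_0,\ldots,\alpha_{d-1}}\delta_{\alpha_{k-1},\ell}\prod_{j=1}^dG_j(\alpha_{j-1},i_j,\alpha_j)$ (with $\alpha_d=\alpha_0$ and $\delta$ the Kronecker delta), so that $T_\ell^{\tau_k}$ is represented by the cores $G_k(\ell,\cdot,\cdot),G_{k+1},\ldots,G_{k-2},G_{k-1}(\cdot,\cdot,\ell)$, with $0$-th rank $1$. (2) Form a TR-representation of the sum $S=\sum_{\ell=1}^{r_{k-1}}T_\ell^{\tau_k}$ by applying the addition of TR-representations with $0$-th rank $1$ (horizontal concatenation of the first cores, block diagonal matrices formed from the $j$-th cores for $2\le j\le d-1$, vertical concatenation of the last cores) to the cores $G_k(\ell,\cdot,\cdot),G_{k+1},\ldots,G_{k-2},G_{k-1}(\cdot,\cdot,\ell)$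 of $T_\ell^{\tau_k}$, $\ell=1,\ldots,r_{k-1}$. (3) Return $\widetilde T=S^{\tau_k^{-1}}$, with the cores of $S$ cyclically shifted back, so that the first core of $S$ becomes the $k$-th core of $\widetilde T$. *)

(* Defs.v *)
From mathcomp Require Import all_boot all_order all_fingroup all_algebra.
From mathcomp Require Import reals.

Set Implicit Arguments.
Unset Strict Implicit.
Unset Printing Implicit Defensive.

Import GRing.Theory.
Local Open Scope ring_scope.

(* Vertices 1, .., d of the ring are numbered 0, .., d-1 by 'I_d, and ordS is
   the cyclic successor.  [rk G j] is the rank of the edge entering vertex j,
   so core j has slices of size rk j x rk (ordS j): with 1-based vertices and
   ranks r_0, .., r_d, the core G_(j+1) is [core G j] and r_j is [rk G j] for
   j < d; r_d = r_0 holds by cyclicity of ordS. *)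
Record tr_rep (R : realType) (d : nat) (n : 'I_d -> nat) := TRRep {
  rk : 'I_d -> nat;
  core : forall j : 'I_d, 'I_(n j) -> 'M[R]_(rk j, rk (ordS j)) }.

Definition tensor (R : realType) (d : nat) (n : 'I_d -> nat) :=
  (forall j : 'I_d, 'I_(n j)) -> R.

Definition tr_val (R : realType) (d : nat) (n : 'I_d -> nat)
    (G : tr_rep R n) : tensor R n :=
  fun i => \sum_(a : {dffun forall j : 'I_d, 'I_(rk G j)})
             \prod_(j < d) core G (i j) (a j) (a (ordS j)).

Definition tr_represents (R : realType) (d : nat) (n : 'I_d -> nat)
    (G : tr_rep R n) (T : tensor R n) :=
  forall i, T i = tr_val G i.

(* gamma maps vertex 1 to d and j to j - 1. *)
Definition gamma (d : nat) : {perm 'I_d} := perm (can_inj (@ord_predK d)).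

(* With k 0-based, gamma ^+ k is the (k+1)-th cyclic shift tau_(k+1). *)
Definition tau (d : nat) (k : 'I_d) : {perm 'I_d} := (gamma d ^+ k)%g.

Lemma tau_cyclic (d : nat) (k : 'I_d) : tau k \in <[gamma d]>%g.
Proof. exact: mem_cycle. Qed.

Lemma cyclic_ordS (d : nat) (t : {perm 'I_d}) :
  t \in <[gamma d]>%g -> forall j, (t^-1)%g (ordS j) = ordS ((t^-1)%g j).
Proof.
move=> /cycleP[m ->] j; apply: (@perm_inj _ (gamma d ^+ m)%g); rewrite permKV.
have cS s x : (gamma d ^+ s)%g (ordS x) = ordS ((gamma d ^+ s)%g x).
  elim: s x => [|s IHs] x; first by rewrite !expg0 !perm1.
  by rewrite expgSr !permM IHs !permE /= ordSK ord_predK.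
by rewrite cS permKV.
Qed.

(* TR-representation of T^t, for a cyclic shift t, from one of T: core j is
   core t^-1(j).  The mode sizes n' of T^t are n \o t^-1; they are a separate
   argument so that shifting back can land in the original mode sizes
   definitionally. *)
Definition tr_shift (R : realType) (d : nat) (n n' : 'I_d -> nat)
    (t : {perm 'I_d}) (ct : t \in <[gamma d]>%g)
    (en : forall j, n' j = n ((t^-1)%g j)) (G : tr_rep R n) : tr_rep R n' :=
  TRRep (rk := fun j => rk G ((t^-1)%g j))
    (fun j i => castmx (erefl, congr1 (rk G) (esym (cyclic_ordS ct j)))
                  (core G (cast_ord (en j) i))).

(* The index l on edge o, and the identity on every other edge. *)
Definition cut_index (d : nat) (r : 'I_d -> nat) (o : 'I_d) (l : 'I_(r o))
    (j : 'I_d) : 'I_(if j == o then 1 else r j) -> 'I_(r j) :=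
  match j == o as b return (b -> j = o) -> 'I_(if b then 1 else r j) -> 'I_(r j)
  with
  | true => fun e _ => cast_ord (congr1 r (esym (e isT))) l
  | false => fun _ a => a
  end (elimT eqP).

(* Keeps row l of the core leaving edge o and column l of the core entering
   it; all other cores are unchanged. *)
Definition tr_cut (R : realType) (d : nat) (n : 'I_d -> nat) (G : tr_rep R n)
    (o : 'I_d) (l : 'I_(rk G o)) : tr_rep R n :=
  TRRep (rk := fun j => if j == o then 1%N else rk G j)
    (fun j i => mxsub (@cut_index d (rk G) o l j)
                      (@cut_index d (rk G) o l (ordS j)) (core G i)).

Lemma rk_tr_cut (R : realType) (d : nat) (n : 'I_d -> nat) (G : tr_rep R n)
    (o : 'I_d) (l : 'I_(rk G o)) : rk (tr_cut l) o = 1%N.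
Proof. by rewrite /= eqxx. Qed.

(* mxdiag with rectangular blocks. *)
Definition rect_mxdiag (R : realType) (m : nat) (p q : 'I_m -> nat)
    (B : forall l, 'M[R]_(p l, q l)) : 'M[R]_(\sum_l p l, \sum_l q l) :=
  \mxblock_(l, l') (if l == l' then conform_mx 0 (B l) else 0).

(* a and b tell whether the row, resp. column, index of the core lies on the
   edge of rank 1 shared by all summands.  Both hold only for d = 1. *)
Definition join_mx (R : realType) (m : nat) (a b : bool) (p q : 'I_m -> nat) :
    (a -> forall l, p l = 1%N) -> (b -> forall l, q l = 1%N) ->
    (forall l, 'M[R]_(p l, q l)) ->
    'M[R]_(if a then 1 else \sum_l p l, if b then 1 else \sum_l q l) :=
  match a, b return
    (a -> forall l, p l = 1%N) -> (b -> forall l, q l = 1%N) ->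
    (forall l, 'M[R]_(p l, q l)) ->
    'M[R]_(if a then 1 else \sum_l p l, if b then 1 else \sum_l q l)
  with
  | true, false => fun ha _ B => \mxrow_l castmx (ha isT l, erefl) (B l)
  | false, false => fun _ _ B => rect_mxdiag B
  | false, true => fun _ hb B => \mxcol_l castmx (erefl, hb isT l) (B l)
  | true, true => fun ha hb B => \sum_l castmx (ha isT l, hb isT l) (B l)
  end.

Lemma rk_at (R : realType) (d m : nat) (n : 'I_d -> nat)
    (X : 'I_m -> tr_rep R n) (o : 'I_d) (h : forall l, rk (X l) o = 1%N)
    (j : 'I_d) : j == o -> forall l, rk (X l) j = 1%N.
Proof. by move=> /eqP->. Qed.

(* With o the first vertex, the core of index j is the first one if j == o and
   the last one if ordS j == o. *)
Definition tr_add (R : realType) (d m : nat) (n : 'I_d -> nat)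
    (X : 'I_m -> tr_rep R n) (o : 'I_d) (h : forall l, rk (X l) o = 1%N) :
    tr_rep R n :=
  TRRep (rk := fun j => if j == o then 1%N else (\sum_(l < m) rk (X l) j)%N)
    (fun j i => join_mx (@rk_at R d m n X o h j) (@rk_at R d m n X o h (ordS j))
                  (fun l => core (X l) i)).

Lemma shift_back_modes (d : nat) (n : 'I_d -> nat) (t : {perm 'I_d}) (j : 'I_d) :
  n j = n ((t^-1)%g (((t^-1)^-1)%g j)).
Proof. by rewrite permKV. Qed.

Definition edge_deletion (R : realType) (d : nat) (hd : (2 <= d)%N)
    (n : 'I_d -> nat) (G : tr_rep R n) (k : 'I_d) : tr_rep R n :=
  let o : 'I_d := Ordinal (ltnW hd) in
  let Gk := tr_shift (n' := fun j => n (((tau k)^-1)%g j)) (tau_cyclic k)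
              (fun=> erefl) G in
  let S := tr_add (X := fun l : 'I_(rk Gk o) => tr_cut l)
             (fun l => rk_tr_cut l) in
  tr_shift (groupVr (tau_cyclic k)) (shift_back_modes n (tau k)) S.

(* Main.v *)
Require Import Defs.
From mathcomp Require Import all_boot all_order all_fingroup all_algebra.
From mathcomp Require Import reals.

(** Both the entries of a TR-representation and those of its edge deletion are
    sums, over all assignments of an index to each edge of the ring, of a
    product of core entries; the theorem compares the index sets of these sums.

    Renumbering the vertices by a cyclic shift permutes the edge assignments
    and the factors of each product ([tr_val_shift]), so the two shifts of the
    algorithm cancel and the edge to be deleted may be taken to be the first
    one.  Cutting this edge sorts the assignments by the index l that they
    give to it, so that the value is the sum over l of the values of the cut
    representations ([tr_val_cut]).  Finally, an assignment for the sum of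
    TR-representations picks, on each edge but the first, a summand l together
    with an index of the corresponding edge of summand l.  As the inner cores
    are block diagonal, its product vanishes unless the same summand is picked
    all along the ring, and the remaining assignments are exactly those of the
    separate summands ([tr_val_add]).

    The last two comparisons have the same shape: disjoint injective images of
    the index sets of several sums cover the support of one sum
    ([sum_disjoint_images]). *)

Set Implicit Arguments.
Unset Strict Implicit.
Unset Printing Implicit Defensive.

Import GRing.Theory.
Local Open Scope ring_scope.

(** * Finite sums and cyclic indices *)

Lemma sum_disjoint_images (V : nmodType) (L A : finType) (B : L -> finType)
    (E : forall l, B l -> A) (F : A -> V) :
    (forall l l' b b', E l b = E l' b' -> l = l') ->
    (forall l, injective (E l)) ->
    (forall a, F a != 0 -> exists l b, a = E l b) ->
  \sum_a F a = \sum_l \sum_b F (E l b).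
Proof.
move=> disjE injE coverE; rewrite sig_big_dep /=.
pose h (p : {l : L & B l}) := E (tag p) (tagged p).
have injh : {in predT &, injective h}.
  move=> [l b] [l' b'] _ _ eqE.
  have eql : l = l' := disjE _ _ _ _ eqE.
  by case: l' / eql b' eqE => b' eqE; rewrite (injE l b b' eqE).
rewrite -(big_imset F injh) /=; symmetry; apply: big_rmcond => a aNh.
apply: contraTeq (aNh) => /coverE[l [b ->]]; rewrite negbK.
by apply/imsetP; exists (existT _ l b).
Qed.

Lemma val_dep_ord (d : nat) (r : 'I_d -> nat) (x : forall j, 'I_(r j)) j j' :
  j = j' -> x j = x j' :> nat.
Proof. by move->. Qed.

Lemma ordS_ind (d : nat) (P : 'I_d -> Prop) (o : 'I_d) :
  P o -> (forall j, P j -> P (ordS j)) -> forall j, P j.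
Proof.
move=> Po PS j.
have valE s : iter s (@ordS d) o = ((o + s) %% d)%N :> nat.
  elim: s => [|s IHs]; first by rewrite addn0 modn_small.
  by rewrite iterS /= IHs -addn1 modnDml addn1 addnS.
have -> : j = iter (j + (d - o))%N (@ordS d) o.
  by apply: val_inj; rewrite /= valE addnCA subnKC 1?ltnW // modnDr modn_small.
by elim: (j + _)%N => //= s; apply: PS.
Qed.

Lemma ordS_neq (d : nat) (j : 'I_d) : (2 <= d)%N -> ordS j != j.
Proof.
move=> d2; apply/eqP => /(congr1 val) /= eqj.
have := ltn_ord j; rewrite leq_eqVlt => /orP[/eqP jd|jd].
  by move: eqj d2; rewrite jd modnn => j0; rewrite -[X in (1 < X)%N]jd -j0.
by move: eqj; rewrite modn_small // => /esym/n_Sn.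
Qed.

(** * Cyclic shifts *)

Lemma tr_val_shift (R : realType) (d : nat) (n n' : 'I_d -> nat)
    (t : {perm 'I_d}) (ct : t \in <[gamma d]>%g)
    (en : forall j, n' j = n ((t^-1)%g j)) (G : tr_rep R n)
    (i : forall j, 'I_(n j)) (i' : forall j, 'I_(n' j)) :
    (forall j, cast_ord (en j) (i' j) = i ((t^-1)%g j)) ->
  tr_val (tr_shift ct en G) i' = tr_val G i.
Proof.
move=> ii'; rewrite /tr_val /=.
pose h (a : {dffun forall j, 'I_(rk G j)}) :
  {dffun forall j, 'I_(rk G ((t^-1)%g j))} := [ffun j => a ((t^-1)%g j)].
pose g (b : {dffun forall j, 'I_(rk G ((t^-1)%g j))}) :
    {dffun forall j, 'I_(rk G j)} :=
  [ffun j => cast_ord (congr1 (rk G) (permK t j)) (b (t j))].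
rewrite (reindex h) /=; last first.
  exists g => a _; apply/ffunP => j; apply: val_inj; rewrite !ffunE /= ?ffunE.
    by apply: (val_dep_ord a); rewrite permK.
  by apply: (val_dep_ord a); rewrite permKV.
apply: eq_bigr => a _; rewrite [RHS](reindex_inj (@perm_inj _ (t^-1)%g)) /=.
apply: eq_bigr => j _; rewrite castmxE /= ii' !ffunE cast_ord_id.
congr (core G _ _ _); apply: val_inj => /=.
by apply: (val_dep_ord a); rewrite (cyclic_ordS ct).
Qed.

(** The shift used by the algorithm brings vertex k to the first place. *)
Lemma tau_first (d : nat) (hd : (0 < d)%N) (k : 'I_d) :
  tau k k = Ordinal hd.
Proof.
have gammaX s (x : 'I_d) : (s <= x)%N -> (gamma d ^+ s)%g x = (x - s)%N :> nat.
  elim: s => [|s IHs] sx; first by rewrite expg0 perm1 subn0.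
  rewrite expgSr permM permE /= IHs 1?ltnW //.
  rewrite -[X in (X + d)%N](@prednK (x - s)) ?subn_gt0 // addSn /= modnDr.
  rewrite modn_small; first by rewrite subnS.
  by rewrite (leq_ltn_trans (leq_pred _)) // (leq_ltn_trans (leq_subr _ _)).
by apply: val_inj; rewrite /= gammaX // subnn.
Qed.

(** * Cutting an edge *)

Lemma cut_index_at (d : nat) (r : 'I_d -> nat) (o : 'I_d) (l : 'I_(r o))
    (j : 'I_d) (x : 'I_(if j == o then 1 else r j)) :
  j == o -> cut_index l x = l :> nat.
Proof.
rewrite /cut_index; move: (elimT eqP) x.
by case: (j == o).
Qed.

Lemma cut_index_off (d : nat) (r : 'I_d -> nat) (o : 'I_d) (l : 'I_(r o))
    (j : 'I_d) (x : 'I_(if j == o then 1 else r j)) :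
  j != o -> cut_index l x = x :> nat.
Proof.
rewrite /cut_index; move: (elimT eqP) x.
by case: (j == o).
Qed.

Lemma cut_index_inj (d : nat) (r : 'I_d -> nat) (o : 'I_d) (l : 'I_(r o))
    (j : 'I_d) : injective (@cut_index d r o l j).
Proof.
move=> x y /(congr1 val) /=; have /orP[jo _|jo] := orbN (j == o).
  by move: x y; rewrite jo => x y; rewrite !ord1.
by rewrite !cut_index_off // => /val_inj.
Qed.

(** The assignments of the l-th cut are those of G that give l to edge o. *)
Lemma tr_val_cut (R : realType) (d : nat) (n : 'I_d -> nat) (G : tr_rep R n)
    (o : 'I_d) (i : forall j, 'I_(n j)) :
  tr_val G i = \sum_(l < rk G o) tr_val (tr_cut l) i.
Proof.
pose E (l : 'I_(rk G o)) (b : {dffun forall j, 'I_(rk (tr_cut l) j)}) :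
  {dffun forall j, 'I_(rk G j)} := [ffun j => cut_index l (b j)].
have valE l b j : E l b j = cut_index l (b j) by rewrite ffunE.
rewrite {1}/tr_val (sum_disjoint_images (E := E)).
- apply: eq_bigr => l _; apply: eq_bigr => b _; apply: eq_bigr => j _.
  by rewrite mxE !valE.
- move=> l l' b b' /ffunP/(_ o)/(congr1 val).
  by rewrite /= !valE !cut_index_at // => /val_inj.
- move=> l b b' /ffunP eqE; apply/ffunP => j.
  by move: (eqE j); rewrite !valE; apply: cut_index_inj.
move=> a _; have /fin_all_exists[b bP] j :
    exists x : 'I_(rk (tr_cut (a o)) j), a j = cut_index (a o) x.
  have [jo|jo] := boolP (j == o).
    have x : 'I_(rk (tr_cut (a o)) j) by rewrite /= jo; exact: ord0.
    exists x; apply: val_inj; rewrite /= cut_index_at //.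
    by apply: (val_dep_ord a); apply/eqP.
  have e : rk G j = rk (tr_cut (a o)) j by rewrite /= (negPf jo).
  exists (cast_ord e (a j)); apply: val_inj.
  by rewrite /= cut_index_off.
exists (a o), [ffun j => b j]; apply/ffunP => j.
by rewrite valE ffunE bP.
Qed.

(** * Adding representations *)

(** The place of the index x of summand l on an edge of the sum; the flag a
    marks the edge of rank 1 shared by all summands. *)
Definition join_index (m : nat) (a : bool) (p : 'I_m -> nat) (l : 'I_m)
    (x : 'I_(p l)) : 'I_(if a then 1 else \sum_l p l) :=
  match a return 'I_(if a then 1 else \sum_l p l) with
  | true => ord0
  | false => tagnat.Rank l x
  end.

Lemma join_index_inj (m : nat) (a : bool) (p : 'I_m -> nat) (l : 'I_m) :
  (a -> p l = 1%N) -> injective (@join_index m a p l).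
Proof.
case: a => [/(_ isT) pl1 x y _|_ x y /= /(congr1 val) /eqP].
  by apply: (can_inj (cast_ordK pl1)); rewrite !ord1.
by rewrite tagnat.eq_Rank eqxx => /eqP /val_inj.
Qed.

Lemma join_index_label (m : nat) (a : bool) (p : 'I_m -> nat) (l l' : 'I_m)
    (x : 'I_(p l)) (x' : 'I_(p l')) :
  ~~ a -> join_index a x = join_index a x' -> l = l'.
Proof.
case: a => //= _ /(congr1 val) /eqP.
by rewrite tagnat.eq_Rank => /andP[/eqP].
Qed.

Lemma join_index_surj (m : nat) (a : bool) (p : 'I_m -> nat)
    (z : 'I_(if a then 1 else \sum_l p l)) :
  ~~ a -> exists l (x : 'I_(p l)), z = join_index a x.
Proof.
case: a z => // z _; exists (tagnat.sig1 z), (tagnat.sig2 z).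
by rewrite /= tagnat.sig2K.
Qed.

Lemma join_index_shared (m : nat) (a : bool) (p : 'I_m -> nat) (l : 'I_m)
    (z : 'I_(if a then 1 else \sum_l p l)) :
  a -> p l = 1%N -> exists x : 'I_(p l), z = join_index a x.
Proof.
by case: a z => // z _ pl1; exists (cast_ord (esym pl1) ord0); rewrite !ord1.
Qed.

Lemma rect_mxdiagE (R : realType) (m : nat) (p q : 'I_m -> nat)
    (B : forall l, 'M[R]_(p l, q l)) l l' (x : 'I_(p l)) (y : 'I_(q l')) :
  rect_mxdiag B (tagnat.Rank l x) (tagnat.Rank l' y) =
  (if l == l' then conform_mx 0 (B l) else 0) x y.
Proof.
have /matrixP/(_ x y) := mxblockK
  (fun l l' => if l == l' then conform_mx 0 (B l) else 0 : 'M[R]_(p l, q l')) l l'.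
by rewrite mxE.
Qed.

Lemma join_mxE (R : realType) (m : nat) (a b : bool) (p q : 'I_m -> nat)
    (ha : a -> forall l, p l = 1%N) (hb : b -> forall l, q l = 1%N)
    (B : forall l, 'M[R]_(p l, q l)) l (x : 'I_(p l)) (y : 'I_(q l)) :
  ~~ (a && b) -> join_mx ha hb B (join_index a x) (join_index b y) = B l x y.
Proof.
case: a b ha hb => [] [] //= ha' hb' _.
- have /matrixP/(_ ord0 y) :=
    mxrowK (fun l => castmx (ha' isT l, erefl) (B l)) l.
  rewrite mxE => ->; rewrite castmxE cast_ord_id; congr (B _ _).
  by apply: (can_inj (cast_ordK (ha' isT l))); rewrite !ord1.
- have /matrixP/(_ x ord0) :=
    mxcolK (fun l => castmx (erefl, hb' isT l) (B l)) l.
  rewrite mxE => ->; rewrite castmxE cast_ord_id; congr (B _ _).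
  by apply: (can_inj (cast_ordK (hb' isT l))); rewrite !ord1.
by rewrite rect_mxdiagE eqxx conform_mx_id.
Qed.

(** Block diagonality: a nonzero entry stays within one summand. *)
Lemma join_mx_neq0 (R : realType) (m : nat) (a b : bool) (p q : 'I_m -> nat)
    (ha : a -> forall l, p l = 1%N) (hb : b -> forall l, q l = 1%N)
    (B : forall l, 'M[R]_(p l, q l)) l (x : 'I_(p l))
    (w : 'I_(if b then 1 else \sum_l q l)) :
    ~~ a -> join_mx ha hb B (join_index a x) w != 0 ->
  exists y : 'I_(q l), w = join_index b y.
Proof.
case: a b ha hb w => [] [] //= ha' hb' w _.
  by move=> _; exact: (@join_index_shared _ true) (hb' isT l).
have [l' [y ->]] := @join_index_surj _ false _ w isT.
rewrite /= rect_mxdiagE; case: eqP y => [<- y _|_ y]; first by exists y.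
by rewrite mxE eqxx.
Qed.

(** With at least two vertices no core is both the first and the last one:
    every core of the sum consists of blocks, and the index on the edge leaving
    the first vertex determines the summand. *)
Lemma tr_val_add (R : realType) (d m : nat) (n : 'I_d -> nat)
    (X : 'I_m -> tr_rep R n) (o : 'I_d) (h : forall l, rk (X l) o = 1%N)
    (i : forall j, 'I_(n j)) :
  (2 <= d)%N -> tr_val (tr_add h) i = \sum_l tr_val (X l) i.
Proof.
move=> d2; have oS := ordS_neq o d2.
pose J j l := @join_index m (j == o) (fun l => rk (X l) j) l.
pose E (l : 'I_m) (b : {dffun forall j, 'I_(rk (X l) j)}) :
  {dffun forall j, 'I_(rk (tr_add h) j)} := [ffun j => J j l (b j)].
have valE l b j : E l b j = J j l (b j) by rewrite ffunE.
rewrite {1}/tr_val (sum_disjoint_images (E := E)).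
- apply: eq_bigr => l _; apply: eq_bigr => b _; apply: eq_bigr => j _.
  rewrite !valE /= join_mxE //.
  by apply/andP => -[/eqP-> /idPn].
- move=> l l' b b' /ffunP/(_ (ordS o)); rewrite !valE.
  exact: join_index_label.
- move=> l b b' /ffunP eqE; apply/ffunP => j.
  move: (eqE j); rewrite !valE; apply: join_index_inj.
  by move=> /eqP->.
move=> a; rewrite prodf_seq_neq0 => /allP nz.
(* The summand is read off on the edge leaving o, which is not the shared one,
   and then followed around the ring. *)
have [l [x0 ax0]] := join_index_surj (a (ordS o)) oS.
exists l; suff /fin_all_exists[b bP] : forall j, exists x, a j = J j l x.
  by exists [ffun j => b j]; apply/ffunP => j; rewrite valE ffunE.
apply: (@ordS_ind _ _ o); first exact: (join_index_shared (a o) (eqxx o) (h l)).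
move=> j [x ax]; have [->|jo] := eqVneq j o; first by exists x0.
(* Core j has a nonzero entry, hence stays in the block of summand l. *)
have := nz j (mem_index_enum j); rewrite /= ax.
exact: join_mx_neq0.
Qed.

Theorem theorem4p2 (R : realType) (d : nat) (hd : (2 <= d)%N)
    (n : 'I_d -> nat) (T : tensor R n) (G : tr_rep R n)
    (hG : tr_represents G T) (k : 'I_d) :
  rk (edge_deletion hd G k) k = 1%N /\
  (forall i : (forall j : 'I_d, 'I_(n j)),
     tr_val (edge_deletion hd G k) i = T i).
Proof.
split=> [|i]; first by rewrite /= invgK (tau_first (ltnW hd)) eqxx.
pose i0 j : 'I_(n (((tau k)^-1)%g j)) := i (((tau k)^-1)%g j).
rewrite hG /edge_deletion (@tr_val_shift _ _ _ _ _ _ _ _ i0); last first.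
  move=> j; apply: val_inj => /=.
  by apply: (val_dep_ord i); rewrite permKV.
rewrite tr_val_add // -tr_val_cut.
by apply: tr_val_shift => j; rewrite cast_ord_id.
Qed.
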